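(* Let $k\in[1,m]$ and consider $\mathcal{K}=\{i\in[1,m] : r_i=r_k\}$. Then, $(\alpha,\eta,z)$ is a feasible point of Problem (P1) if and only if there exists a vector $\bar z\in\{0,1\}^{m+1-|\mathcal{K}|}$ (with entries indexed by $\{k\}\cup[1,m]\setminus\mathcal{K}$) such that $(\alpha,\eta,\bar z)$ is a feasible point of the problem (P2) $$\min_{\alpha,\eta,z}\ \eta$$ subject to $$\alpha^\top r_i\le -1+z_iM,\quad i\in\{k\}\cup[1,m]\setminus\mathcal{K},$$ $$\alpha^\top r_i\ge 1-(1-z_i)M,\quad i\in\{k\}\cup[1,m]\setminus\mathcal{K},$$ $$\lambda-\eta\le\sum_{i\in[1,m]\setminus\mathcal{K}}z_i+|\mathcal{K}|\,z_k\le\lambda+\eta,$$ $$\ell\le\alpha_j\le u,\quad j\in[1,t],$$ $$0\le\eta\le\bar\eta,$$ $$z_i\in\{0,1\},\quad i\in\{k\}\cup[1,m]\setminus\mathcal{K}.$$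
   Context: Notation: $[1,n]=\{1,\dots,n\}$ for a positive integer $n$, and $\{k\}\cup[1,m]\setminus\mathcal{K}$ means $\{k\}\cup([1,m]\setminus\mathcal{K})$. Here $t$ is the number of decision trees, $m$ is the number of unlabeled points, $r_i\in\{-1,1\}^t$ is the vector of classifications of the $i$-th unlabeled point by the $t$ trees, and $\lambda\in\mathbb{N}$ is the known total number of the $m$ unlabeled points that belong to the positive class (so $\lambda\le m$). Further, $u>\ell>0$ are real numbers, $\bar\eta=\max\{\lambda,m-\lambda\}$, and $M$ is a big-$M$ constant that is chosen sufficiently large (for instance, $M=ut+1$ is a valid choice). Problem (P1) is the mixed-integer linear problem in the variables $\alpha\in\mathbb{R}^t$, $\eta\in\mathbb{R}$, $z\in\{0,1\}^m$: $$\min_{\alpha,\eta,z}\ \eta$$ subject to $$\alpha^\top r_i\le -1+z_iM,\quad i\in[1,m],$$ $$\alpha^\top r_i\ge 1-(1-z_i)M,\quad i\in[1,m],$$ $$\lambda-\eta\le\sum_{i=1}^m z_i\le\lambda+\eta,$$ $$\ell\le\alpha_j\le u,\quad j\in[1,t],$$ $$0\le\eta\le\bar\eta,$$ $$z_i\in\{0,1\},\quad i\in[1,m].$$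
   Formalization: Read for a fixed z unrelated to z̄, the ''if'' part fails; the formal statement links them (z_i = z̄_i off K, z_i = z̄_k on K) and also proves that (α,η) extends to a feasible point of (P1) iff it extends to one of (P2). *)

(* Defs.v *)
From HB Require Import structures.
From mathcomp Require Import all_boot all_order all_algebra.

Set Implicit Arguments.
Unset Strict Implicit.
Unset Printing Implicit Defensive.

Import Order.TTheory GRing.Theory Num.Theory.
Local Open Scope ring_scope.

Definition dot (R : realFieldType) (t : nat) (a b : 'cV[R]_t) : R :=
  (a^T *m b) 0 0.

Definition binary (R : realFieldType) (x : R) : Prop := x = 0 \/ x = 1.

Definition eta_bar (R : realFieldType) (m lam : nat) : R :=
  (maxn lam (m - lam))%:R.

(* "M is sufficiently large": on the box [l, u]^t, the first family of
   constraints is redundant when z_i = 1 and the second one when z_i = 0.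
   Any M >= u * t + 1 has this property. *)
Definition valid_bigM (R : realFieldType) (t m : nat)
    (r : 'I_m -> 'cV[R]_t) (l u M : R) : Prop :=
  forall alpha : 'cV[R]_t, (forall j, l <= alpha j 0 <= u) ->
  forall i, dot alpha (r i) <= -1 + M /\ dot alpha (r i) >= 1 - M.

Record feasible_P1 (R : realFieldType) (t m : nat)
    (r : 'I_m -> 'cV[R]_t) (lam : nat) (l u M : R)
    (alpha : 'cV[R]_t) (eta : R) (z : {ffun 'I_m -> R}) : Prop := FeasibleP1 {
  P1_upper : forall i, dot alpha (r i) <= -1 + z i * M;
  P1_lower : forall i, dot alpha (r i) >= 1 - (1 - z i) * M;
  P1_count : lam%:R - eta <= \sum_(i < m) z i <= lam%:R + eta;
  P1_alpha : forall j, l <= alpha j 0 <= u;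
  P1_eta : 0 <= eta <= eta_bar R m lam;
  P1_binary : forall i, binary (z i) }.

Definition same_class (R : realFieldType) (t m : nat)
    (r : 'I_m -> 'cV[R]_t) (k : 'I_m) : {set 'I_m} :=
  [set i | r i == r k].

Definition reduced_set (R : realFieldType) (t m : nat)
    (r : 'I_m -> 'cV[R]_t) (k : 'I_m) : {set 'I_m} :=
  k |: ([set: 'I_m] :\: same_class r k).

Definition reduced_index (R : realFieldType) (t m : nat)
    (r : 'I_m -> 'cV[R]_t) (k : 'I_m) : finType :=
  {i : 'I_m | i \in reduced_set r k}.

Definition reduced_k (R : realFieldType) (t m : nat)
    (r : 'I_m -> 'cV[R]_t) (k : 'I_m) : reduced_index r k :=
  exist _ k (setU11 k _).

Lemma card_reduced_index (R : realFieldType) (t m : nat)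
    (r : 'I_m -> 'cV[R]_t) (k : 'I_m) :
  #|reduced_index r k| = (m + 1 - #|same_class r k|)%N.
Proof.
have -> : #|reduced_index r k| = #|reduced_set r k| by rewrite card_sig.
rewrite cardsU1 setTD !inE eqxx /=.
have := cardsC (same_class r k); rewrite card_ord.
by move: #|_| #|~: _| => a b <-; rewrite -addnA addKn addnC.
Qed.

Record feasible_P2 (R : realFieldType) (t m : nat)
    (r : 'I_m -> 'cV[R]_t) (k : 'I_m) (lam : nat) (l u M : R)
    (alpha : 'cV[R]_t) (eta : R) (z : {ffun reduced_index r k -> R}) : Prop :=
    FeasibleP2 {
  P2_upper : forall i : reduced_index r k,
    dot alpha (r (val i)) <= -1 + z i * M;
  P2_lower : forall i : reduced_index r k,
    dot alpha (r (val i)) >= 1 - (1 - z i) * M;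
  P2_count : lam%:R - eta <=
      \sum_(i : reduced_index r k | val i \notin same_class r k) z i
      + #|same_class r k|%:R * z (reduced_k r k)
    <= lam%:R + eta;
  P2_alpha : forall j, l <= alpha j 0 <= u;
  P2_eta : 0 <= eta <= eta_bar R m lam;
  P2_binary : forall i, binary (z i) }.

(* [insubd] returns i itself when i lies in the reduced index set and k
   otherwise, so every coordinate in [same_class r k] receives the value at k. *)
Definition expand (R : realFieldType) (t m : nat)
    (r : 'I_m -> 'cV[R]_t) (k : 'I_m) (zbar : {ffun reduced_index r k -> R}) :
    {ffun 'I_m -> R} :=
  [ffun i => zbar (insubd (reduced_k r k) i)].

(* Main.v *)
Require Import Defs.
From HB Require Import structures.
From mathcomp Require Import all_boot all_order all_algebra.

Set Implicit Arguments.
Unset Strict Implicit.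
Unset Printing Implicit Defensive.

Import Order.TTheory GRing.Theory Num.Theory.
Local Open Scope ring_scope.

(** The big-M constraints tie a binary [z i] to the score [dot alpha (r i)]: if
    [z i = 0] the first one reads [dot alpha (r i) <= -1], and if [z i = 1] the
    second one reads [dot alpha (r i) >= 1].  So in any feasible point [z i] is
    the indicator of [1 <= dot alpha (r i)] ([binary_bigM_eq]), and it depends
    on [i] only through [r i].  Every feasible [z] is therefore constant on the
    class of [k], that is, [z] is [expand] of its own restriction to the reduced
    index set ([feasible_P1_expand_restrict]).

    It remains to compare the two problems on vectors of the form
    [expand zbar].  Copying the value at [k] duplicates the constraints
    of [k], and the sum over the class collapses to its cardinality times
    [zbar k], so [expand zbar] is feasible for the full problem exactly when
    [zbar] is feasible for the reduced one ([feasible_P1_expand]). *)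

(** Each value of [x] makes the big-M term vanish in one of the two constraints,
    and the constraint that is left decides the sign of [d]. *)
Lemma binary_bigM_eq (R : realFieldType) (x d M : R) :
  binary x -> d <= -1 + x * M -> 1 - (1 - x) * M <= d -> x = (1 <= d)%R%:R.
Proof.
case=> ->; first rewrite mul0r addr0 => d_le _.
  suff /lt_geF-> : d < 1 by [].
  by apply: le_lt_trans d_le _; apply: lt_trans ltr01; rewrite oppr_lt0 ltr01.
by move=> _; rewrite subrr mul0r subr0 => ->.
Qed.

Section Expansion.

Variables (R : realFieldType) (t m : nat) (r : 'I_m -> 'cV[R]_t) (k : 'I_m).
Implicit Types (zbar : {ffun reduced_index r k -> R}) (z : {ffun 'I_m -> R}).

Local Notation rep := (insubd (reduced_k r k)).

Lemma mem_reduced_set i : i \notin same_class r k -> i \in reduced_set r k.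
Proof. by move=> iNK; rewrite !inE; move: iNK; rewrite inE => ->; rewrite orbT. Qed.

Lemma r_rep i : r (val (rep i)) = r i.
Proof.
rewrite val_insubd; case: ifPn => // iNred.
by apply/esym/eqP; apply: contraNT iNred => iNK; rewrite mem_reduced_set ?inE.
Qed.

Lemma expand_val zbar (j : reduced_index r k) : expand zbar (val j) = zbar j.
Proof. by rewrite ffunE valKd. Qed.

(** For [i] in the class, [rep i] is [k] in both cases: either [i] lies outside
    the reduced index set, or [i] is [k] itself. *)
Lemma expand_same_class zbar i :
  i \in same_class r k -> expand zbar i = zbar (reduced_k r k).
Proof.
move=> iK; rewrite ffunE; congr (zbar _); apply: val_inj.
rewrite val_insubd; case: ifPn => //.
by rewrite !inE; move: iK; rewrite inE => -> /=; rewrite orbF => /eqP.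
Qed.

Lemma sum_expand zbar :
  \sum_(i < m) expand zbar i =
    \sum_(j : reduced_index r k | val j \notin same_class r k) zbar j
    + #|same_class r k|%:R * zbar (reduced_k r k).
Proof.
rewrite (bigID (mem (same_class r k))) /= addrC; congr (_ + _).
  rewrite (reindex_onto val rep) /=; last first.
    by move=> i iNK; rewrite val_insubd mem_reduced_set.
  by apply: eq_big => [j|j _]; rewrite ?expand_val ?valKd ?eqxx ?andbT.
rewrite (eq_bigr (fun=> zbar (reduced_k r k))); last first.
  by move=> i; apply: expand_same_class.
by rewrite sumr_const mulr_natl.
Qed.

Lemma feasible_P1_expand lam (l u M : R) alpha eta zbar :
  feasible_P1 r lam l u M alpha eta (expand zbar) <->
  feasible_P2 lam l u M alpha eta zbar.
Proof.
split=> -[upper lower count Halpha Heta bin]; split=> //.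
- by move=> j; rewrite -(expand_val zbar).
- by move=> j; rewrite -(expand_val zbar).
- by rewrite -sum_expand.
- by move=> j; rewrite -(expand_val zbar).
- by move=> i; rewrite -r_rep ffunE.
- by move=> i; rewrite -r_rep ffunE.
- by rewrite sum_expand.
- by move=> i; rewrite ffunE.
Qed.

Definition restrict z : {ffun reduced_index r k -> R} := [ffun j => z (val j)].

Lemma feasible_P1_expand_restrict lam (l u M : R) alpha eta z :
  feasible_P1 r lam l u M alpha eta z -> z = expand (restrict z).
Proof.
case=> upper lower _ _ _ bin.
have zE i : z i = (1 <= dot alpha (r i))%R%:R by apply: (@binary_bigM_eq _ _ _ M).
by apply/ffunP=> i; rewrite !ffunE !zE r_rep.
Qed.

End Expansion.

Theorem proposition3 (R : realFieldType) (t m : nat) (t_gt0 : (0 < t)%N)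
    (r : 'I_m -> 'cV[R]_t) (r_pm1 : forall i j, r i j 0 = -1 \/ r i j 0 = 1)
    (lam : nat) (lam_le_m : (lam <= m)%N)
    (l u M : R) (l_gt0 : 0 < l) (l_lt_u : l < u) (M_large : valid_bigM r l u M)
    (k : 'I_m) (alpha : 'cV[R]_t) (eta : R) :
  ((exists z : {ffun 'I_m -> R}, feasible_P1 r lam l u M alpha eta z) <->
   (exists zbar : {ffun reduced_index r k -> R},
      feasible_P2 lam l u M alpha eta zbar)) /\
  (forall z : {ffun 'I_m -> R},
     feasible_P1 r lam l u M alpha eta z <->
     exists zbar : {ffun reduced_index r k -> R},
       z = expand zbar /\ feasible_P2 lam l u M alpha eta zbar).
Proof.
have P1_iff z : feasible_P1 r lam l u M alpha eta z <->
    exists zbar : {ffun reduced_index r k -> R},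
      z = expand zbar /\ feasible_P2 lam l u M alpha eta zbar.
  split=> [feas_z | [zbar [-> feas_zbar]]]; last exact/feasible_P1_expand.
  have zE := feasible_P1_expand_restrict k feas_z.
  exists (restrict r k z); split=> //.
  by apply/feasible_P1_expand; rewrite -zE.
split=> //; split=> [[z /P1_iff[zbar [_ feas]]] | [zbar feas]].
  by exists zbar.
by exists (expand zbar); apply/P1_iff; exists zbar.
Qed.
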